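(* Let $V$ be the $2|1$-dimensional complex $\mathbb{Z}_2$-graded vector space with basis $v_1,v_2$ (even) and $v_3$ (odd), and let $d_{12}=\psi^{22}_3+\psi^{23}_1-\psi^{32}_1$. Then a miniversal deformation of $d_{12}$ is given by $$d^\infty=d_{12}+t\,\psi^{31}_1-t\,\psi^{13}_1+t^2\,\psi^{11}_3-t\,\psi^{12}_3-t\,\psi^{21}_3+t\,\psi^{33}_3$$ with base $\mathbb{C}[[t]]$, and it is a jump deformation from $d_{12}$ to $d_1=\psi^{23}_2-\psi^{32}_2+\psi^{22}_3-\psi^{33}_3$: for every sufficiently small $t\in\mathbb{C}\setminus\{0\}$ this codifferential is equivalent to $d_1$.
   Context: Notation: $\psi^{ij}_k:V\otimes V\to V$ is the linear map with $\psi^{ij}_k(v_a\otimes v_b)=v_k$ if $(a,b)=(i,j)$ and $0$ otherwise. A codifferential of degree 2 on $V$ is an odd linear map $d:V\otimes V\to V$ such that for all homogeneous $a,b,c$, $d(d(a,b),c)+(-1)^{|a|}d(a,d(b,c))=0$. Two codifferentials $d,d'$ are equivalent if $d'=g^{-1}\circ d\circ(g\otimes g)$ for some even linear automorphism $g$ of $V$. Deformations: a formal base is a (purely even) commutative unital $\mathbb{C}$-algebra $A$ with an augmentation $A\to\mathbb{C}$ whose kernel $\mathfrak m$ is the unique maximal ideal of $A$ (so $A=\mathbb{C}\oplus\mathfrak m$), and which is complete, $A=\varprojlim_k A/\mathfrak m^k$; it is infinitesimal if $\mathfrak m^2=0$. A deformation of $d$ with base $A$ is $d_A=d+\varphi$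 with $\varphi:V\otimes V\to V\otimes\mathfrak m$ odd and $d_A$ (extended $A$-linearly) satisfying the codifferential identity. Deformations $d_A,d_A'$ are equivalent ($d_A\sim d'_A$) if $d_A'=g^{-1}\circ d_A\circ(g\otimes g)$ for some $A$-linear automorphism $g=I+\lambda$ with $\lambda:V\to V\otimes\mathfrak m$ even. A morphism $f:A\to B$ of augmented algebras pushes $d_A$ forward to $f_*(d_A)=(1\otimes f)d_A$. A deformation $d_A$ with formal base is versal if for every deformation $d_B$ with formal base $B$ there is a morphism $f:A\to B$ with $f_*(d_A)\sim d_B$; it is miniversal if moreover $f$ is unique whenever $B$ is infinitesimal. *)

(* Defs.v *)
From HB Require Import structures.
From mathcomp Require Import all_boot all_order all_algebra.
From mathcomp Require Import boolp classical_sets functions reals.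
From mathcomp Require Import complex.

Set Implicit Arguments.
Unset Strict Implicit.
Unset Printing Implicit Defensive.

Import Order.TTheory GRing.Theory Num.Theory.
Local Open Scope classical_set_scope.
Local Open Scope ring_scope.

(* A Z/2-graded space V with homogeneous basis (v_i)_{i < n} is given by the
   parity par i of each v_i.  For a purely even commutative algebra A, V (x) A
   is 'rV[A]_n, and an A-linear map of V (x) A is a matrix acting on row
   vectors on the right, so that row i of the matrix is the image of v_i. *)

(* A linear map V (x) V -> V (x) A, given by its values on the v_a (x) v_b. *)
Definition cochain (A : nzRingType) (n : nat) :=
  {ffun 'I_n * 'I_n -> 'rV[A]_n}.

Definition psi (A : nzRingType) (n : nat) (i j k : 'I_n) : cochain A n :=
  [ffun ab => if ab == (i, j) then delta_mx 0 k else 0].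

(* The A-linear extension, applied to x (x) y. *)
Definition ev (A : nzRingType) (n : nat) (d : cochain A n)
    (x y : 'rV[A]_n) : 'rV[A]_n :=
  \sum_a \sum_b (x 0 a * y 0 b) *: d (a, b).

(* true is the odd parity. *)
Definition homogeneous (A : nzRingType) (n : nat) (par : 'I_n -> bool)
    (p : bool) (x : 'rV[A]_n) : Prop :=
  forall i, par i != p -> x 0 i = 0.

Definition odd_cochain (A : nzRingType) (n : nat) (par : 'I_n -> bool)
    (d : cochain A n) : Prop :=
  forall a b, homogeneous par (~~ (par a (+) par b)) (d (a, b)).

Definition even_mx (A : nzRingType) (n : nat) (par : 'I_n -> bool)
    (g : 'M[A]_n) : Prop :=
  forall a, homogeneous par (par a) (row a g).

Definition codifferential (A : nzRingType) (n : nat) (par : 'I_n -> bool)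
    (d : cochain A n) : Prop :=
  odd_cochain par d /\
  forall (p q r : bool) (a b c : 'rV[A]_n),
    homogeneous par p a -> homogeneous par q b -> homogeneous par r c ->
    ev d (ev d a b) c + (-1) ^+ p *: ev d a (ev d b c) = 0.

(* conj_by g h d is h o d o (g (x) g), used with h the inverse of g. *)
Definition conj_by (A : nzRingType) (n : nat) (g h : 'M[A]_n)
    (d : cochain A n) : cochain A n :=
  [ffun ab => ev d (row ab.1 g) (row ab.2 g) *m h].

Definition equivalent (A : nzRingType) (n : nat) (par : 'I_n -> bool)
    (d d' : cochain A n) : Prop :=
  [/\ codifferential par d, codifferential par d' &
    exists g h : 'M[A]_n,
      [/\ even_mx par g, g *m h = 1%:M, h *m g = 1%:M & d' = conj_by g h d]].

(* idealr_closed includes 1 \notin M, i.e. M is a proper ideal. *)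
Definition maximal_ideal (A : comNzRingType) (M : {pred A}) : Prop :=
  idealr_closed M /\
  forall N : {pred A}, idealr_closed N -> {subset M <= N} -> N =i M.

Definition ideal_mul (A : comNzRingType) (I J : set A) : set A :=
  [set x | exists (n : nat) (u v : 'I_n -> A),
    [/\ forall i, I (u i), forall i, J (v i) & x = \sum_i u i * v i]].

Fixpoint ideal_pow (A : comNzRingType) (I : set A) (k : nat) : set A :=
  if k is k'.+1 then ideal_mul I (ideal_pow I k') else [set: A].

(* Bijectivity of A -> lim_k A / I^k: an element of the inverse limit is given
   by representatives x_ k of its components. *)
Definition adically_complete (A : comNzRingType) (I : set A) : Prop :=
  forall x_ : nat -> A,
    (forall k, ideal_pow I k (x_ k.+1 - x_ k)) ->
    exists! x, forall k, ideal_pow I k (x - x_ k).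

Definition aug_ideal (K : fieldType) (A : comAlgType K)
    (eps : {lrmorphism A -> K^o}) : {pred A} := [pred x | eps x == 0].

Definition formal_base (K : fieldType) (A : comAlgType K)
    (eps : {lrmorphism A -> K^o}) : Prop :=
  (forall M : {pred A}, maximal_ideal M <-> M =i aug_ideal eps) /\
  adically_complete [set` aug_ideal eps].

Definition infinitesimal (K : fieldType) (A : comAlgType K)
    (eps : {lrmorphism A -> K^o}) : Prop :=
  ideal_pow [set` aug_ideal eps] 2 = [set 0].

Definition base_change (A B : nzRingType) (n : nat) (f : A -> B)
    (d : cochain A n) : cochain B n :=
  [ffun ab => map_mx f (d ab)].

Definition deformation (K : fieldType) (n : nat) (par : 'I_n -> bool)
    (d : cochain K n) (A : comAlgType K) (eps : {lrmorphism A -> K^o})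
    (dA : cochain A n) : Prop :=
  codifferential par d /\
  exists phi : cochain A n,
    [/\ odd_cochain par phi,
        forall ab k, phi ab 0 k \in aug_ideal eps,
        dA = base_change (in_alg A) d + phi &
        codifferential par dA].

Definition deformation_equiv (K : fieldType) (n : nat) (par : 'I_n -> bool)
    (A : comAlgType K) (eps : {lrmorphism A -> K^o})
    (dA dA' : cochain A n) : Prop :=
  exists lambda h : 'M[A]_n,
    let g := 1%:M + lambda in
    [/\ even_mx par lambda,
        forall a b, lambda a b \in aug_ideal eps,
        g *m h = 1%:M, h *m g = 1%:M & dA' = conj_by g h dA].

Definition aug_morphism (K : fieldType) (A B : comAlgType K)
    (epsA : {lrmorphism A -> K^o}) (epsB : {lrmorphism B -> K^o})
    (f : {lrmorphism A -> B}) : Prop :=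
  forall x, epsB (f x) = epsA x.

Definition versal (K : fieldType) (n : nat) (par : 'I_n -> bool)
    (d : cochain K n) (A : comAlgType K) (epsA : {lrmorphism A -> K^o})
    (dA : cochain A n) : Prop :=
  [/\ formal_base epsA, deformation par d epsA dA &
    forall (B : comAlgType K) (epsB : {lrmorphism B -> K^o}),
      formal_base epsB ->
    forall dB : cochain B n, deformation par d epsB dB ->
    exists f : {lrmorphism A -> B},
      aug_morphism epsA epsB f /\
      deformation_equiv par epsB (base_change f dA) dB].

Definition miniversal (K : fieldType) (n : nat) (par : 'I_n -> bool)
    (d : cochain K n) (A : comAlgType K) (epsA : {lrmorphism A -> K^o})
    (dA : cochain A n) : Prop :=
  versal par d epsA dA /\
  forall (B : comAlgType K) (epsB : {lrmorphism B -> K^o}),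
    formal_base epsB -> infinitesimal epsB ->
  forall dB : cochain B n, deformation par d epsB dB ->
  forall f f' : {lrmorphism A -> B},
    aug_morphism epsA epsB f ->
    deformation_equiv par epsB (base_change f dA) dB ->
    aug_morphism epsA epsB f' ->
    deformation_equiv par epsB (base_change f' dA) dB ->
    f =1 f'.

(* K[[t]] as coefficient sequences, with the Cauchy product (not the pointwise
   product that functions into a ring carry). *)
Definition fps (K : comNzRingType) : Type := nat -> K^o.

Section FormalPowerSeries.
Variable K : comNzRingType.

HB.instance Definition _ := GRing.Lmodule.copy (fps K) (nat -> K^o).

Definition fps_one : fps K := fun n => (n == 0%N)%:R.

Definition fps_mul (f g : fps K) : fps K :=
  fun n => \sum_(i < n.+1) f i * g (n - i)%N.

Let trunc (m : nat) (f : fps K) : {poly K} := \poly_(i < m) f i.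

Fact fps_mul_trunc m n f g :
  (n < m)%N -> fps_mul f g n = (trunc m f * trunc m g)`_n.
Proof.
move=> lt_nm; rewrite coefM; apply: eq_bigr => i _; rewrite !coef_poly.
by rewrite (leq_ltn_trans (leq_ord i)) // (leq_ltn_trans (leq_subr _ _)).
Qed.

Fact fps_mulC : commutative fps_mul.
Proof.
move=> f g; apply/funext => n.
by rewrite !(@fps_mul_trunc n.+1) // mulrC.
Qed.

Fact fps_mulA : associative fps_mul.
Proof.
move=> f g h; apply/funext => n.
transitivity ((trunc n.+1 f * (trunc n.+1 g * trunc n.+1 h))`_n).
  rewrite coefM; apply: eq_bigr => i _; rewrite coef_poly ltn_ord.
  by rewrite (@fps_mul_trunc n.+1) // ltnS leq_subr.
rewrite mulrA coefM; apply: eq_bigr => i _.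
by rewrite -(@fps_mul_trunc n.+1) // coef_poly ltnS leq_subr.
Qed.

Fact fps_mul1 : left_id fps_one fps_mul.
Proof.
move=> f; apply/funext => n.
rewrite /fps_mul big_ord_recl /fps_one eqxx mul1r subn0 big1 ?addr0 // => i _.
by rewrite mul0r.
Qed.

Fact fps_mulDl : left_distributive fps_mul +%R.
Proof.
move=> f g h; apply/funext => n.
rewrite /fps_mul -[RHS]/(_ n + _ n) -big_split.
by apply: eq_bigr => i _; exact: mulrDl.
Qed.

Fact fps_one_neq0 : fps_one != 0.
Proof. by apply/eqP => /(congr1 (@^~ 0%N))/eqP; rewrite oner_eq0. Qed.

HB.instance Definition _ := GRing.Zmodule_isComNzRing.Build (fps K)
  fps_mulA fps_mulC fps_mul1 fps_mulDl fps_one_neq0.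

Fact fps_scaleAl (k : K) (f g : fps K) : k *: (f * g) = k *: f * g.
Proof.
apply/funext => n; rewrite -[LHS]/(k * \sum_(i < n.+1) f i * g (n - i)%N).
by rewrite mulr_sumr; apply: eq_bigr => i _; rewrite mulrA.
Qed.

HB.instance Definition _ :=
  GRing.Lmodule_isLalgebra.Build K (fps K) fps_scaleAl.
HB.instance Definition _ := GRing.Lalgebra_isComAlgebra.Build K (fps K).

Definition fps_var : fps K := fun n => (n == 1%N)%:R.

Definition fps_aug (f : fps K) : K^o := f 0%N.

Fact fps_aug_linear : linear fps_aug.
Proof. by []. Qed.

Fact fps_aug_monoid : monoid_morphism fps_aug.
Proof.
by split=> // f g; rewrite /fps_aug -[LHS]/(fps_mul f g 0%N) /fps_mul big_ord1.
Qed.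

HB.instance Definition _ :=
  GRing.isLinear.Build K (fps K) K^o _ fps_aug fps_aug_linear.
HB.instance Definition _ :=
  GRing.isMonoidMorphism.Build (fps K) K^o fps_aug fps_aug_monoid.

End FormalPowerSeries.

Definition e1 : 'I_3 := Ordinal (isT : 0 < 3)%N.
Definition e2 : 'I_3 := Ordinal (isT : 1 < 3)%N.
Definition e3 : 'I_3 := Ordinal (isT : 2 < 3)%N.

(* Dimension 2|1: v_1, v_2 even and v_3 odd. *)
Definition par21 (i : 'I_3) : bool := i == e3.

Definition d1 (A : nzRingType) : cochain A 3 :=
  psi A e2 e3 e2 - psi A e3 e2 e2 + psi A e2 e2 e3 - psi A e3 e3 e3.

Definition d12 (A : nzRingType) : cochain A 3 :=
  psi A e2 e2 e3 + psi A e2 e3 e1 - psi A e3 e2 e1.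

Definition dinf (A : nzRingType) (t : A) : cochain A 3 :=
  d12 A + t *: psi A e3 e1 e1 - t *: psi A e1 e3 e1 + t ^+ 2 *: psi A e1 e1 e3
  - t *: psi A e1 e2 e3 - t *: psi A e2 e1 e3 + t *: psi A e3 e3 e3.

(* Main.v *)
Require Import Defs.
From HB Require Import structures.
From mathcomp Require Import all_boot all_order all_algebra.
From mathcomp Require Import boolp classical_sets functions reals.
From mathcomp Require Import complex.
From mathcomp Require Import zify ring.
Import Order.TTheory GRing.Theory Num.Theory.
Local Open Scope ring_scope.
Local Open Scope complex_scope.

Set Implicit Arguments.
Unset Strict Implicit.
Unset Printing Implicit Defensive.

(** Over a complete augmented algebra, the codifferential equations can be solved in
    closed form: a deformation of [d12] is determined by a unit [c], a linear form [w] and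
    a vector [u] of the even part (see [codifferential_normal_form]), and one change of
    basis brings it to [dinf t] with [t = c r], where [r v3] is the value at [(v3, v3)].
    The classifying morphism is evaluation of power series at [t]; when [m ^ 2 = 0] the
    coefficient [r] is an invariant of the equivalence class, which gives uniqueness. *)

(** * Powers of the augmentation ideal [m] and convergence of power series *)

Section AugmentedAlgebra.
Variables (K : fieldType) (A : comAlgType K) (eps : {lrmorphism A -> K^o}).
Local Notation I := [set` aug_ideal eps]%classic.

Lemma in_aug x : (x \in aug_ideal eps) = (eps x == 0).
Proof. by []. Qed.

Lemma aug_alg (k : K) : eps (k%:A) = k.
Proof. by rewrite linearZ rmorph1 /= /GRing.scale /= mulr1. Qed.

Lemma ideal_pow0 k : ideal_pow I k 0.
Proof.
case: k => [|k] //; exists 0%N, (fun=> 0), (fun=> 0).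
by split=> [[]|[]|] //; rewrite big_ord0.
Qed.

Lemma ideal_powD k x y : ideal_pow I k x -> ideal_pow I k y -> ideal_pow I k (x + y).
Proof.
case: k => [|k] // [m [u [v [uI vI ->]]]] [n [u' [v' [uI' vI' ->]]]].
exists (m + n)%N, (fun i : 'I_(m + n) => match fintype.split i with inl j => u j | inr j => u' j end),
  (fun i : 'I_(m + n) => match fintype.split i with inl j => v j | inr j => v' j end).
split=> [i|i|]; try by case: (fintype.split i).
rewrite big_split_ord /=; congr (_ + _); apply: eq_bigr => i _.
  by rewrite (unsplitK (inl i)).
by rewrite (unsplitK (inr i)).
Qed.

Lemma ideal_powMl k a x : ideal_pow I k x -> ideal_pow I k (a * x).
Proof.
elim: k a x => [|k IH] a x //= [n [u [v [uI vI ->]]]].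
exists n, u, (fun i => a * v i); split=> // [i|]; first exact: IH.
by rewrite mulr_sumr; apply: eq_bigr => i _; rewrite mulrCA.
Qed.

Lemma ideal_powB k x y : ideal_pow I k x -> ideal_pow I k y -> ideal_pow I k (x - y).
Proof. by move=> xI yI; rewrite -mulN1r; apply/ideal_powD/ideal_powMl. Qed.

Lemma ideal_powS k b x : eps b = 0 -> ideal_pow I k x -> ideal_pow I k.+1 (b * x).
Proof.
move=> b0 xI; exists 1%N, (fun=> b), (fun=> x); split=> // [i|].
  by apply/eqP.
by rewrite big_ord1.
Qed.

Hypothesis cA : adically_complete I.

(** This is the uniqueness half of completeness, applied to the zero sequence, of which both [x] and
    [0] are limits. *)
Lemma ideal_pow_separated x : (forall k, ideal_pow I k x) -> x = 0.
Proof.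
move=> xI; have [|y [_ yU]] := cA (x_ := fun=> 0).
  by move=> k; rewrite subrr; exact: ideal_pow0.
rewrite -(yU x) ?(yU 0) // => k; rewrite subr0 //; exact: ideal_pow0.
Qed.

Variable b : A.
Hypothesis b0 : eps b = 0.

Lemma ideal_pow_expr k : ideal_pow I k (b ^+ k).
Proof. by elim: k => [|k IH] //; rewrite exprS; exact: ideal_powS. Qed.

(** Consecutive partial sums differ by a multiple of [b ^+ k], which lies in [m ^ k], so
    completeness supplies a limit. *)
Lemma fps_eval_subproof (a : fps K) :
  exists x : A, forall k, ideal_pow I k (x - \sum_(i < k) (a i : K) *: b ^+ i).
Proof.
have [|x [xP _]] := cA (x_ := fun k => \sum_(i < k) (a i : K) *: b ^+ i).
  move=> k; rewrite big_ord_recr /= addrAC subrr add0r -mulr_algl.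
  by apply/ideal_powMl/ideal_pow_expr.
by exists x.
Qed.

Definition fps_eval_at (a : fps K) : A := sval (cid (fps_eval_subproof a)).

Lemma fps_eval_atP (a : fps K) k :
  ideal_pow I k (fps_eval_at a - \sum_(i < k) (a i : K) *: b ^+ i).
Proof. exact: (svalP (cid (fps_eval_subproof a))). Qed.

(** Identities between evaluations thus reduce to congruences for partial sums modulo every
    [m ^ k]. *)
Lemma fps_eval_at_unique (a : fps K) (x : A) :
  (forall k, ideal_pow I k (x - \sum_(i < k) (a i : K) *: b ^+ i)) ->
  fps_eval_at a = x.
Proof.
move=> xP; apply/eqP; rewrite -subr_eq0; apply/eqP/ideal_pow_separated => k.
by have := ideal_powB (fps_eval_atP a k) (xP k); rewrite opprB addrA subrK.
Qed.

Lemma fps_eval_at_linear : linear fps_eval_at.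
Proof.
move=> k x y; apply: fps_eval_at_unique => n.
have -> : \sum_(i < n) ((k *: x + y : fps K) i : K) *: b ^+ i =
   k *: (\sum_(i < n) (x i : K) *: b ^+ i) + \sum_(i < n) (y i : K) *: b ^+ i.
  rewrite scaler_sumr -big_split; apply: eq_bigr => i _ /=.
  by rewrite scalerA -scalerDl.
rewrite opprD addrACA -scalerBr; apply: ideal_powD (fps_eval_atP y n).
by rewrite -mulr_algl; exact/ideal_powMl/fps_eval_atP.
Qed.

End AugmentedAlgebra.

(** * The [t]-adic topology of [K[[t]]] *)

Section FormalPowerSeriesTheory.
Variable K : fieldType.
Implicit Types f g : fps K.
Local Notation t := (fps_var K).
Local Notation I := [set` aug_ideal (@fps_aug K)]%classic.

Lemma fps_mulE f g n : (f * g) n = \sum_(i < n.+1) f i * g (n - i)%N.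
Proof. by []. Qed.

Lemma fps_varM0 f : (t * f) 0%N = 0.
Proof. by rewrite fps_mulE big_ord1 mul0r. Qed.

Lemma fps_varMS f n : (t * f) n.+1 = f n.
Proof.
rewrite fps_mulE !big_ord_recl big1 /= => [|i _]; last by rewrite mul0r.
by rewrite mul0r mul1r add0r addr0 subn1.
Qed.

Definition fps_shift f : fps K := fun n => f n.+1.

Lemma fps_shift_decomp f : f = (f 0%N : K)%:A + t * fps_shift f.
Proof.
apply/funext => -[|n]; rewrite -[RHS]/(_ * _ + (t * fps_shift f) _).
  by rewrite fps_varM0 addr0 mulr1.
by rewrite fps_varMS mulr0 add0r.
Qed.

Lemma fps_ideal_powP k f :
  ideal_pow I k f <-> (forall i, (i < k)%N -> f i = 0).
Proof.
elim: k f => [|k IH] f; first by split.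
split=> [[n [u [v [uI vI ->]]]] i ltik|f0].
  rewrite (_ : (\sum_j u j * v j) i = \sum_j (u j * v j) i); last first.
    by apply: (big_morph (fun h : fps K => h i)).
  apply: big1 => j _; rewrite fps_mulE; apply: big1 => l _.
  (* The term of index 0 dies because [u j] has no constant term; in the others the coefficient of
     [v j] has index below [k]. *)
  case: l => -[|l] /= ltl.
    by have /eqP := uI j; rewrite /= /fps_aug => ->; rewrite mul0r.
  by rewrite ((IH (v j)).1 (vI j)) ?mulr0 //; lia.
rewrite (fps_shift_decomp f) f0 // scale0r add0r.
apply: ideal_powS => //; apply/IH => i ltik; exact: f0.
Qed.

Lemma fps_adically_complete : adically_complete I.
Proof.
move=> x_ xP.
have stab i m : (i < m)%N -> x_ m i = x_ i.+1 i.
  elim: m => // m IH; rewrite ltnS leq_eqVlt => /predU1P[->//|lt_im].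
  have /fps_ideal_powP/(_ i lt_im)/eqP := xP m.
  by rewrite -[_ i]/(x_ m.+1 i - x_ m i) subr_eq0 IH // => /eqP.
(* [x_ n] is only meaningful modulo [t ^ n], so the coefficient of index [n] is read off [x_ n.+1],
   where it has become stable. *)
exists (fun n => x_ n.+1 n); split=> [k|y yP].
  apply/fps_ideal_powP => i lt_ik.
  by rewrite -[LHS]/(x_ i.+1 i - x_ k i) stab // subrr.
apply/funext => n; have /fps_ideal_powP/(_ n (ltnSn n))/eqP := yP n.+1.
by rewrite -[_ n]/(y n - x_ n.+1 n) subr_eq0 => /eqP.
Qed.

End FormalPowerSeriesTheory.

(** * Evaluation at [b] in [m] as a morphism of augmented algebras *)

Section Evaluation.
Variables (K : fieldType) (A : comAlgType K) (eps : {lrmorphism A -> K^o}).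
Local Notation I := [set` aug_ideal eps]%classic.
Hypothesis cA : adically_complete I.
Variable b : A.
Hypothesis b0 : eps b = 0.

Definition fps_eval (f : fps K) : A := fps_eval_at cA b0 f.

HB.instance Definition _ :=
  GRing.isLinear.Build K (fps K) A _ fps_eval (fps_eval_at_linear cA b0).

Lemma fps_eval1 : fps_eval 1 = 1.
Proof.
apply: fps_eval_at_unique => -[|k] //; rewrite big_ord_recl scale1r expr0.
rewrite big1 => [|i _]; first by rewrite addr0 subrr; exact: ideal_pow0.
by rewrite /= scale0r.
Qed.

Lemma fps_eval_varM f : fps_eval (fps_var K * f) = b * fps_eval f.
Proof.
apply: fps_eval_at_unique => -[|k] //.
rewrite big_ord_recl fps_varM0 scale0r add0r.
under eq_bigr do rewrite /= fps_varMS exprS scalerAr.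
by rewrite -mulr_sumr -mulrBr; apply: ideal_powS (fps_eval_atP _ _ _ _).
Qed.

(** Modulo [m ^ k], by induction on [k] for all [f]: after writing [f] as its constant term plus [t]
    times its shift, the constant parts cancel and the defect for [f] is [b] times the defect for
    the shift. *)
Lemma fps_evalM : {morph fps_eval : f g / f * g}.
Proof.
move=> f g; apply/eqP; rewrite -subr_eq0; apply/eqP/(ideal_pow_separated cA) => k.
elim: k f => // k IH f.
rewrite (fps_shift_decomp f) mulrDl -mulrA !raddfD /= !fps_eval_varM.
rewrite -!scalerAl mul1r !linearZ /= fps_eval1 mulrDl -scalerAl mul1r -mulrA.
by rewrite opprD addrACA subrr add0r -mulrBr; exact: ideal_powS.
Qed.

Lemma fps_eval_monoid : monoid_morphism fps_eval.
Proof. by split; [exact: fps_eval1 | exact: fps_evalM]. Qed.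

HB.instance Definition _ :=
  GRing.isMonoidMorphism.Build (fps K) A fps_eval fps_eval_monoid.

Lemma fps_eval_var : fps_eval (fps_var K) = b.
Proof. by rewrite -[fps_var K]mulr1 fps_eval_varM fps_eval1 mulr1. Qed.

Lemma aug_fps_eval : aug_morphism (@fps_aug K) eps fps_eval.
Proof.
move=> f; rewrite [in LHS](fps_shift_decomp f) raddfD raddfD /= fps_eval_varM rmorphM /=.
by rewrite b0 mul0r addr0 linearZ /= fps_eval1 aug_alg.
Qed.

End Evaluation.

(** * Complete augmented algebras are local *)

Section Local.
Variables (K : fieldType) (A : comAlgType K) (eps : {lrmorphism A -> K^o}).
Hypothesis cA : adically_complete [set` aug_ideal eps]%classic.

(** Geometric series: [x] is [k] times [1 - b] with [b] in [m], and [1 - b] is inverted by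
    evaluating the series [ones], the inverse of [1 - t], at [b]. *)
Lemma complete_inverse (x : A) : eps x != 0 -> exists y, x * y = 1.
Proof.
move=> x0; pose k : K := eps x; pose b := 1 - k^-1 *: x.
have b0 : eps b = 0.
  by rewrite raddfB /= rmorph1 linearZ /= /GRing.scale /= mulVf ?subrr.
pose ones : fps K := fun=> 1.
have onesE : (1 - fps_var K) * ones = 1.
  by rewrite mulrBl mul1r {1}(fps_shift_decomp ones) addrK scale1r.
exists (k^-1 *: fps_eval cA b0 ones).
have /(congr1 (fps_eval cA b0)) := onesE.
rewrite rmorphM rmorphB /= fps_eval1 fps_eval_var => <-.
by rewrite -scalerAr scalerAl /b subKr.
Qed.

Lemma complete_formal_base : formal_base eps.
Proof.
have idm : idealr_closed (aug_ideal eps).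
  split=> [||a u v]; rewrite !in_aug ?raddf0 ?rmorph1 ?oner_eq0 //.
  by move=> /eqP u0 /eqP v0; rewrite rmorphD rmorphM /= u0 v0 mulr0 addr0.
(* A proper ideal contains no unit, and everything outside [m] is a unit. *)
have sub (N : {pred A}) : idealr_closed N -> {subset N <= aug_ideal eps}.
  move=> [N0 N1 ND] x xN; rewrite in_aug; apply: contraNT N1.
  by move=> /complete_inverse[y <-]; rewrite mulrC -[y * x]addr0; exact: ND.
split=> // M; split=> [[idM maxM]|eqM].
  by move=> x; rewrite (maxM _ idm (sub _ idM)).
have idM : idealr_closed M.
  have [m0 m1 mD] := idm; split=> [||a u v]; rewrite !eqM //; exact: mD.
split=> // N idN MN x; apply/idP/idP => [/(sub _ idN)|/MN //].
by rewrite eqM.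
Qed.

End Local.

Lemma fps_formal_base (K : fieldType) : formal_base (@fps_aug K).
Proof. exact/complete_formal_base/fps_adically_complete. Qed.

(** * Cochains in coordinates and their base change *)

Lemma ord3_ind (P : 'I_3 -> Prop) : P e1 -> P e2 -> P e3 -> forall i, P i.
Proof.
move=> P1 P2 P3 [[|[|[|//]]] lt_i].
- by rewrite (_ : Ordinal lt_i = e1) //; exact: val_inj.
- by rewrite (_ : Ordinal lt_i = e2) //; exact: val_inj.
- by rewrite (_ : Ordinal lt_i = e3) //; exact: val_inj.
Qed.

Lemma sum_ord3 (V : nmodType) (F : 'I_3 -> V) : \sum_i F i = F e1 + F e2 + F e3.
Proof.
rewrite !big_ord_recr big_ord0 /= add0r.
by congr (F _ + F _ + F _); exact: val_inj.
Qed.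

Section Cochains.
Variables (A : comNzRingType) (n : nat).
Implicit Types (d : cochain A n) (x y : 'rV[A]_n).

Lemma cochainDE d d' ab k : (d + d') ab 0 k = d ab 0 k + d' ab 0 k.
Proof. by rewrite !ffunE mxE. Qed.

Lemma cochainNE d ab k : (- d) ab 0 k = - d ab 0 k.
Proof. by rewrite !ffunE mxE. Qed.

Lemma evD d d' x y : ev (d + d') x y = ev d x y + ev d' x y.
Proof.
rewrite /ev -big_split; apply: eq_bigr => a _; rewrite -big_split.
by apply: eq_bigr => b _; rewrite ffunE scalerDr.
Qed.

Lemma evZ k d x y : ev (k *: d) x y = k *: ev d x y.
Proof.
rewrite /ev scaler_sumr; apply: eq_bigr => a _; rewrite scaler_sumr.
by apply: eq_bigr => b _; rewrite ffunE !scalerA mulrC.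
Qed.

Lemma evN d x y : ev (- d) x y = - ev d x y.
Proof. by rewrite -scaleN1r evZ scaleN1r. Qed.

Lemma ev_psi i j k x y : ev (psi A i j k) x y = (x 0 i * y 0 j) *: delta_mx 0 k.
Proof.
rewrite /ev (bigD1 i) //= [X in _ + X]big1 ?addr0 => [|a ai].
  rewrite (bigD1 j) //= [X in _ + X]big1 ?addr0 => [|b bj].
    by rewrite ffunE eqxx.
  by rewrite ffunE xpair_eqE (negbTE bj) andbF scaler0.
by apply: big1 => b _; rewrite ffunE xpair_eqE (negbTE ai) scaler0.
Qed.

Lemma ev_deltal d i y : ev d (delta_mx 0 i) y = \sum_b y 0 b *: d (i, b).
Proof.
rewrite /ev (bigD1 i) //= [X in _ + X]big1 ?addr0 => [|a ai].
  by apply: eq_bigr => b _; rewrite mxE !eqxx mul1r.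
by apply: big1 => b _; rewrite mxE (negbTE ai) andbF mul0r scale0r.
Qed.

Lemma ev_deltar d x j : ev d x (delta_mx 0 j) = \sum_a x 0 a *: d (a, j).
Proof.
apply: eq_bigr => a _; rewrite (bigD1 j) //= [X in _ + X]big1 ?addr0 => [|b bj].
  by rewrite mxE !eqxx mulr1.
by rewrite mxE (negbTE bj) andbF mulr0 scale0r.
Qed.

Lemma ev_delta d i j : ev d (delta_mx 0 i) (delta_mx 0 j) = d (i, j).
Proof.
rewrite ev_deltal (bigD1 j) //= [X in _ + X]big1 ?addr0 => [|b bj].
  by rewrite mxE !eqxx scale1r.
by rewrite mxE (negbTE bj) andbF scale0r.
Qed.

Lemma homogeneous_delta (par : 'I_n -> bool) i :
  homogeneous par (par i) (delta_mx 0 i : 'rV[A]_n).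
Proof. by move=> j; rewrite mxE eqxx; have [->|] := eqVneq j i; rewrite ?eqxx. Qed.

Lemma codifferential_coef (par : 'I_n -> bool) d : codifferential par d ->
  forall i j k m, \sum_l d (i, j) 0 l * d (l, k) 0 m +
    (-1) ^+ par i * (\sum_l d (j, k) 0 l * d (i, l) 0 m) = 0.
Proof.
case=> _ dP i j k m.
have /(congr1 (fun x : 'rV[A]_n => x 0 m)) :=
  dP _ _ _ _ _ _ (@homogeneous_delta par i) (@homogeneous_delta par j)
    (@homogeneous_delta par k).
rewrite !ev_delta ev_deltar ev_deltal !mxE !summxE => E; rewrite -[RHS]E.
by congr (_ + _ * _); apply: eq_bigr => l _; rewrite mxE.
Qed.

End Cochains.

Section BaseChange.
Variables (A B : comNzRingType) (f : {rmorphism A -> B}) (n : nat).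
Implicit Types d : cochain A n.

Lemma base_changeE d ab k : base_change f d ab 0 k = f (d ab 0 k).
Proof. by rewrite ffunE mxE. Qed.

Lemma base_changeD d d' : base_change f (d + d') = base_change f d + base_change f d'.
Proof. by apply/ffunP => ab; rewrite !ffunE map_mxD. Qed.

Lemma base_changeN d : base_change f (- d) = - base_change f d.
Proof. by apply/ffunP => ab; rewrite !ffunE map_mxN. Qed.

Lemma base_changeZ k d : base_change f (k *: d) = f k *: base_change f d.
Proof. by apply/ffunP => ab; rewrite !ffunE map_mxZ. Qed.

Lemma base_change_psi i j k : base_change f (psi A i j k) = psi B i j k :> cochain B n.
Proof.
apply/ffunP => ab; rewrite !ffunE; case: ifP => _; last exact: map_mx0.
exact: map_delta_mx.
Qed.

End BaseChange.

Lemma base_change_dinf (A B : comNzRingType) (f : {rmorphism A -> B}) (t : A) :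
  base_change f (dinf t) = dinf (f t).
Proof.
rewrite /dinf /d12.
rewrite !(base_changeD, base_changeN, base_changeZ, base_change_psi).
by rewrite rmorphXn.
Qed.

(** * The codifferentials [dinf t] and [d1], and even matrices in dimension 2|1 *)

Section Codifferentials.
Variable A : comNzRingType.
Implicit Types (t : A) (x y : 'rV[A]_3).

Lemma d12_dinf : d12 A = dinf 0.
Proof. by rewrite /dinf expr0n !scale0r !subr0 !addr0. Qed.

(** On even vectors the [v3]-component of [dinf t] is the rank one form [wform t x * wform t y]; the
    brackets with [v3] factor through the same linear form. *)
Definition wform t x : A := x 0 e2 - t * x 0 e1.

Lemma ev_dinf1 t x y :
  ev (dinf t) x y 0 e1 = wform t x * y 0 e3 - x 0 e3 * wform t y.
Proof. rewrite !(evD, evN, evZ, ev_psi) !mxE /= /wform; ring. Qed.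

Lemma ev_dinf2 t x y : ev (dinf t) x y 0 e2 = 0.
Proof. rewrite !(evD, evN, evZ, ev_psi) !mxE /=; ring. Qed.

Lemma ev_dinf3 t x y :
  ev (dinf t) x y 0 e3 = wform t x * wform t y + t * x 0 e3 * y 0 e3.
Proof. rewrite !(evD, evN, evZ, ev_psi) !mxE /= /wform; ring. Qed.

Definition ev_dinfE := (ev_dinf1, ev_dinf2, ev_dinf3).

Lemma ev_d1_1 x y : ev (d1 A) x y 0 e1 = 0.
Proof. rewrite !(evD, evN, evZ, ev_psi) !mxE /=; ring. Qed.

Lemma ev_d1_2 x y : ev (d1 A) x y 0 e2 = x 0 e2 * y 0 e3 - x 0 e3 * y 0 e2.
Proof. rewrite !(evD, evN, evZ, ev_psi) !mxE /=; ring. Qed.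

Lemma ev_d1_3 x y : ev (d1 A) x y 0 e3 = x 0 e2 * y 0 e2 - x 0 e3 * y 0 e3.
Proof. rewrite !(evD, evN, evZ, ev_psi) !mxE /=; ring. Qed.

Definition ev_d1E := (ev_d1_1, ev_d1_2, ev_d1_3).

Lemma homogeneous21 p x : homogeneous par21 p x ->
  if p then x 0 e1 = 0 /\ x 0 e2 = 0 else x 0 e3 = 0.
Proof. by case: p => h; [split|]; apply: h. Qed.

Lemma codifferential_dinf t : codifferential par21 (dinf t).
Proof.
split=> [a b k|p q r a b c /homogeneous21 ap _ _].
  rewrite -ev_delta; elim/ord3_ind: k; elim/ord3_ind: a; elim/ord3_ind: b => //= _;
    rewrite ev_dinfE /wform ?mxE /=; ring.
apply/rowP => k; rewrite !mxE; elim/ord3_ind: k; rewrite !ev_dinfE /wform;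
  rewrite ?ev_dinfE /wform; (case: p ap => [[a1 a2]|a3]; [rewrite ?a1 ?a2 | rewrite ?a3]); rewrite /=; ring.
Qed.

Lemma codifferential_d1 : codifferential par21 (d1 A).
Proof.
split=> [a b k|p q r a b c /homogeneous21 ap _ _].
  rewrite -ev_delta; elim/ord3_ind: k; elim/ord3_ind: a; elim/ord3_ind: b => //= _;
    rewrite ev_d1E ?mxE /=; ring.
apply/rowP => k; rewrite !mxE; elim/ord3_ind: k; rewrite !ev_d1E;
  rewrite ?ev_d1E; (case: p ap => [[a1 a2]|a3]; [rewrite ?a1 ?a2 | rewrite ?a3]); rewrite /=; ring.
Qed.

(** The general even endomorphism: a 2 by 2 block on [v1], [v2] and the scalar [s] on [v3]. *)
Definition mx21 (a b p q s : A) : 'M[A]_3 :=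
  \matrix_(i, j) nth 0 (nth [::] [:: [:: a; b; 0]; [:: p; q; 0]; [:: 0; 0; s]] i) j.

Lemma even_mx21 a b p q s : even_mx par21 (mx21 a b p q s).
Proof.
by move=> i j; rewrite !mxE; elim/ord3_ind: i; elim/ord3_ind: j.
Qed.

Lemma mul_mx21 a b p q s a' b' p' q' s' :
  mx21 a b p q s *m mx21 a' b' p' q' s' =
  mx21 (a * a' + b * p') (a * b' + b * q') (p * a' + q * p') (p * b' + q * q') (s * s').
Proof.
apply/matrixP => i j; rewrite !mxE sum_ord3 !mxE.
by elim/ord3_ind: i; elim/ord3_ind: j => /=; ring.
Qed.

Lemma mx21_1 : mx21 1 0 0 1 1 = 1%:M.
Proof. by apply/matrixP => i j; rewrite !mxE; elim/ord3_ind: i; elim/ord3_ind: j. Qed.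

End Codifferentials.

(** * Solving the codifferential equations when [c] and [u1] are units *)

Section NormalForm.
Variables (A : comNzRingType) (d : cochain A 3).
Hypothesis codiff : codifferential par21 d.
Local Notation D i j k := (d (i, j) 0 k).
Local Notation c := (D e2 e2 e3).
Local Notation u1 := (D e2 e3 e1).
Local Notation u2 := (D e2 e3 e2).
Variables ci ui : A.
Hypotheses (cK : c * ci = 1) (uK : u1 * ui = 1).

Let solve_c x y : c * x + y = 0 -> x = - (ci * y).
Proof.
move=> E; have -> : x = ci * (c * x + y) - (c * ci - 1) * x - ci * y by ring.
by rewrite E cK subrr mul0r mulr0 !subr0 sub0r.
Qed.

Let D_odd i j k : par21 k != ~~ (par21 i (+) par21 j) -> D i j k = 0.
Proof. by have [oddd _] := codiff; exact: oddd. Qed.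

Let eqn i j k m : D i j e1 * D e1 k m + D i j e2 * D e2 k m + D i j e3 * D e3 k m
  + (-1) ^+ par21 i * (D j k e1 * D i e1 m + D j k e2 * D i e2 m + D j k e3 * D i e3 m) = 0.
Proof. by have := codifferential_coef codiff i j k m; rewrite !sum_ord3. Qed.

(** Since [d (e2, e2)] is [c v3] with [c] a unit, the identities at triples containing two adjacent
    [v2] can be solved for products involving [v3]; this gives [D32], [D31], [D13] and later
    [D33]. *)
Let D32 m : par21 m = false -> D e3 e2 m = - D e2 e3 m.
Proof.
move=> m_even; have := eqn e2 e2 e2 m.
rewrite !(@D_odd e2 e2 e1, @D_odd e2 e2 e2) //= => E.
have /solve_c -> : c * D e3 e2 m + c * D e2 e3 m = 0 by rewrite -[RHS]E; ring.
by rewrite mulrA (mulrC ci) cK mul1r.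
Qed.

Let D31 m : par21 m = false -> D e3 e1 m = - (ci * D e2 e1 e3 * D e2 e3 m).
Proof.
move=> m_even; have := eqn e2 e2 e1 m.
rewrite !(@D_odd e2 e2 e1, @D_odd e2 e2 e2, @D_odd e2 e1 e1, @D_odd e2 e1 e2) //= => E.
rewrite -mulrA; apply: solve_c; rewrite -[RHS]E; ring.
Qed.

Let D13 m : par21 m = false -> D e1 e3 m = ci * D e1 e2 e3 * D e2 e3 m.
Proof.
move=> m_even; have := eqn e1 e2 e2 m.
rewrite !(@D_odd e2 e2 e1, @D_odd e2 e2 e2, @D_odd e1 e2 e1, @D_odd e1 e2 e2) //=.
rewrite D32 // => E.
rewrite -[RHS]opprK -mulrA -mulrN; apply: solve_c; rewrite -[RHS]E; ring.
Qed.

Let cancel_u x : u1 * x = 0 -> x = 0.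
Proof. by move=> E; rewrite -[x]mul1r -uK -mulrA mulrCA E mulr0. Qed.

(** Here the identity carries the unit [u1] as a factor. With [D11], obtained likewise, it makes the
    form on the even part symmetric of rank one. *)
Let D21 : D e2 e1 e3 = D e1 e2 e3.
Proof.
have := eqn e2 e1 e2 e1.
rewrite !(@D_odd e2 e1 e1, @D_odd e2 e1 e2, @D_odd e1 e2 e1, @D_odd e1 e2 e2) //=.
rewrite D32 // => E; apply/esym/subr0_eq/cancel_u; rewrite -[RHS]E; ring.
Qed.

Let D11 : D e1 e1 e3 = ci * D e1 e2 e3 ^+ 2.
Proof.
have := eqn e1 e1 e2 e1.
rewrite !(@D_odd e1 e1 e1, @D_odd e1 e1 e2, @D_odd e1 e2 e1, @D_odd e1 e2 e2) //=.
rewrite D32 // D13 // => E; apply/esym/subr0_eq/cancel_u; rewrite -[RHS]E; ring.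
Qed.

Let D33 : D e3 e3 e3 = - (ci * D e1 e2 e3 * u1 + u2).
Proof.
have := eqn e2 e2 e3 e3.
rewrite !(@D_odd e2 e2 e1, @D_odd e2 e2 e2, @D_odd e2 e3 e3) //= D21 => E.
have /solve_c -> : c * D e3 e3 e3 + (u1 * D e1 e2 e3 + u2 * c) = 0.
  by rewrite -[RHS]E; ring.
transitivity (- (ci * D e1 e2 e3 * u1 + c * ci * u2)); first by ring.
by rewrite cK mul1r.
Qed.

(* With [w] the linear form [v1 |-> ci * D e1 e2 e3], [v2 |-> 1] and [u] the even part
   of [d (e2, e3)], the equations say that [d (a, b) = c w(a) w(b) v3],
   [d (a, v3) = - d (v3, a) = w(a) u] and [d (v3, v3) = - w(u) v3].  The change of basis
   [v1 |-> c u], [v2 |-> v2], [v3 |-> c v3] then turns [d] into [dinf t]. *)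
Lemma codifferential_normal_form :
  d = conj_by (mx21 (ci * ui) (- (u2 * ui)) 0 1 ci) (mx21 (c * u1) (c * u2) 0 1 c)
        (dinf (c * D e3 e3 e3)).
Proof.
set t := c * D e3 e3 e3; set g := mx21 _ _ _ _ _.
(* [W1], [W2], [W3] say that [wform t] pulls back along [g] to [w]; by [D33], this is where the
   value [t = c r] enters. *)
have W1 : wform t (row e1 g) = ci * D e1 e2 e3.
  rewrite /wform !mxE /= /t D33; apply/subr0_eq.
  transitivity (ci * D e1 e2 e3 * (c * ci * (u1 * ui) - 1) + u2 * ui * (c * ci - 1)).
    by ring.
  by rewrite cK uK mulr1 subrr !mulr0 addr0.
have W2 : wform t (row e2 g) = 1 by rewrite /wform !mxE /=; ring.
have W3 : wform t (row e3 g) = 0 by rewrite /wform !mxE /=; ring.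
have K x : x * c * ci = x by rewrite -mulrA cK mulr1.
apply/ffunP => -[i j]; rewrite ffunE; apply/rowP => k.
rewrite mxE sum_ord3 /= !ev_dinfE.
elim/ord3_ind: i; elim/ord3_ind: j; rewrite ?W1 ?W2 ?W3 !mxE /=;
  elim/ord3_ind: k => /=.
all: try (rewrite [LHS]D_odd //; ring).
all: rewrite ?D32 ?D31 ?D13 ?D21 ?D11 //; try ring.
(* The remaining entries agree up to one or two factors [c * ci], which [K] inserts on the left. *)
all: by first [rewrite -[LHS]K; ring | rewrite -[LHS]K -[LHS]K /t; ring].
Qed.

End NormalForm.

(** * The jump to [d1] *)

Lemma equivalent_dinf_d1 (K : fieldType) (k : K) :
  k != 0 -> equivalent par21 (dinf (- k ^+ 2)) (d1 K).
Proof.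
move=> k0; split; [exact: codifferential_dinf | exact: codifferential_d1 |].
(* With [t = - k ^+ 2]: [v1] goes to the kernel of [wform t]; [v3] is scaled by [- t^-1 = k ^- 2],
   so that its square becomes [- v3]; [v2] goes to a multiple of [v1], the direction of the brackets
   with [v3], scaled so that [wform t] takes the value [k^-1], whose square is the scale of [v3]. *)
exists (mx21 1 (- k ^+ 2) (k ^- 3) 0 (k ^- 2)), (mx21 0 (k ^+ 3) (- k ^- 2) k (k ^+ 2)).
split; first exact: even_mx21.
- by rewrite mul_mx21 -mx21_1; congr mx21; field.
- by rewrite mul_mx21 -mx21_1; congr mx21; field.
apply/ffunP => -[i j]; rewrite [RHS]ffunE; apply/rowP => l.
rewrite [RHS]mxE sum_ord3 /= !ev_dinfE /wform /d1 /psi !ffunE.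
by elim/ord3_ind: l; elim/ord3_ind: i; elim/ord3_ind: j; rewrite !mxE /=; field.
Qed.

(** * Deformations of [d12] over complete and infinitesimal bases *)

Section Deformations.
Variables (K : fieldType) (A : comAlgType K) (eps : {lrmorphism A -> K^o}).

Lemma aug_dinf (b : A) ab k : eps b = 0 -> eps (dinf b ab 0 k) = d12 K ab 0 k.
Proof.
by move=> b0; rewrite -base_changeE base_change_dinf /= b0 -d12_dinf.
Qed.

Lemma aug_deformation (dA : cochain A 3) ab k :
  deformation par21 (d12 K) eps dA -> eps (dA ab 0 k) = d12 K ab 0 k.
Proof.
case=> _ [phi [_ phi0 -> _]]; rewrite cochainDE base_changeE raddfD /= aug_alg.
by have /eqP -> := phi0 ab k; rewrite addr0.
Qed.

Lemma deformation_dinf (b : A) : eps b = 0 -> deformation par21 (d12 K) eps (dinf b).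
Proof.
move=> b0; have d12P : codifferential par21 (d12 K).
  by rewrite d12_dinf; exact: codifferential_dinf.
split=> //; exists (dinf b - base_change (in_alg A) (d12 K)); split.
- move=> i j k ij; rewrite cochainDE cochainNE base_changeE.
  by rewrite (codifferential_dinf b).1 // d12P.1 // rmorph0 subrr.
- by move=> ab k; rewrite in_aug cochainDE cochainNE base_changeE raddfB /= aug_dinf // aug_alg subrr.
- by rewrite addrC subrK.
- exact: codifferential_dinf.
Qed.

(** Modulo [m] the entries are those of [d12]: [c] and [u1] reduce to 1, hence are units, and [u2]
    and [r] reduce to 0. So the normal form applies, its matrix [g] reduces to the identity, and
    [c r] lies in [m]. *)
Lemma deformation_equiv_dinf (dA : cochain A 3) :
  adically_complete [set` aug_ideal eps]%classic ->
  deformation par21 (d12 K) eps dA ->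
  exists2 b : A, eps b = 0 & deformation_equiv par21 eps (dinf b) dA.
Proof.
move=> cA defA; have epsA ab k := aug_deformation ab k defA.
have [_ [_ [_ _ _ codiff]]] := defA.
set c := dA (e2, e2) 0 e3; set u1 := dA (e2, e3) 0 e1; set u2 := dA (e2, e3) 0 e2.
have c1 : eps c = 1 by rewrite epsA !ffunE !mxE /=; ring.
have u11 : eps u1 = 1 by rewrite epsA !ffunE !mxE /=; ring.
have u20 : eps u2 = 0 by rewrite epsA !ffunE !mxE /=; ring.
have r0 : eps (dA (e3, e3) 0 e3) = 0 by rewrite epsA !ffunE !mxE /=; ring.
have inv x : eps x = 1 -> exists2 y, x * y = 1 & eps y = 1.
  move=> x1; have [|y xy] := complete_inverse cA (x := x); first by rewrite x1 oner_neq0.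
  by exists y => //; rewrite -[LHS]mul1r -[in LHS]x1 -rmorphM xy rmorph1.
have [ci cK ci1] := inv c c1; have [ui uK ui1] := inv u1 u11.
exists (c * dA (e3, e3) 0 e3); first by rewrite rmorphM /= r0 mulr0.
set g := mx21 (ci * ui) (- (u2 * ui)) 0 1 ci.
exists (g - 1%:M), (mx21 (c * u1) (c * u2) 0 1 c) => /=; rewrite [1%:M + _]addrC subrK.
have cui : c * u1 * (ci * ui) = 1 by rewrite mulrACA cK uK mulr1.
split.
- by move=> i j ij; rewrite !mxE; elim/ord3_ind: i ij; elim/ord3_ind: j => //= _; ring.
- move=> i j; rewrite in_aug !mxE raddfB /=; elim/ord3_ind: i; elim/ord3_ind: j => /=;
    by rewrite ?rmorphN ?rmorphM ?rmorph0 ?rmorph1 /= ?ci1 ?ui1 ?u20 ?mul0r ?oppr0 ?addr0 ?mulr1 ?subrr ?eqxx.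
- rewrite /g mul_mx21 -mx21_1; congr mx21; rewrite ?mul0r ?mulr0 ?addr0 ?mul1r ?add0r //.
  + by rewrite mulrC.
  + transitivity (u2 * (c * ci * ui) - u2 * ui); first by ring.
    by rewrite cK mul1r subrr.
  + by rewrite mulrC.
- rewrite /g mul_mx21 -mx21_1; congr mx21; rewrite ?mul0r ?mulr0 ?addr0 ?mul1r ?add0r //.
  transitivity (c * u2 * (1 - u1 * ui)); first by ring.
  by rewrite uK subrr mulr0.
- exact: codifferential_normal_form.
Qed.

Lemma infinitesimal_mul0 : infinitesimal eps ->
  forall x y : A, eps x = 0 -> eps y = 0 -> x * y = 0.
Proof.
move=> inf x y x0 y0; have : ideal_pow [set` aug_ideal eps]%classic 2 (x * y).
  by apply: ideal_powS => //; rewrite -[y]mulr1; exact: ideal_powS.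
by rewrite inf.
Qed.

(* Conjugation multiplies the [v3]-entry of [d (v3, v3)] by a unit of [1 + m], which does
   nothing when [m ^ 2 = 0]. *)
Lemma infinitesimal_dinf_coef (b : A) (dA : cochain A 3) :
  infinitesimal eps -> eps b = 0 -> deformation_equiv par21 eps (dinf b) dA ->
  dA (e3, e3) 0 e3 = b.
Proof.
move=> /infinitesimal_mul0 mul0 b0 [l [h [/= leven laug _ hg ->]]].
set g := 1%:M + l; set x := conj_by _ _ _ _.
have g0 : (g e3 e1 = 0) * (g e3 e2 = 0) * (g e1 e3 = 0) * (g e2 e3 = 0).
  have l0 i j : par21 j != par21 i -> l i j = 0.
    by move=> ij; have := leven i j ij; rewrite mxE.
  by do !split; rewrite !mxE /= l0 ?addr0.
have l33 : eps (l e3 e3) = 0 by apply/eqP/laug.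
have gE : g e3 e3 = 1 + l e3 e3 by rewrite !mxE.
(* Multiplying back by [g] avoids the entries of [h]: with [s = g e3 e3] the equation reads
   [x 0 e3 * s = b * s * s]. *)
have : (x *m g) 0 e3 = ev (dinf b) (row e3 g) (row e3 g) 0 e3.
  by rewrite /x ffunE -mulmxA hg mulmx1.
rewrite mxE sum_ord3 !g0 !mulr0 !add0r ev_dinfE /wform.
rewrite ![(row e3 g) _ _]mxE !g0 mulr0 subrr mul0r add0r gE.
have bl : b * l e3 e3 = 0 by exact: mul0.
rewrite [b * _]mulrDr mulr1 bl addr0 [b * _]mulrDr mulr1 bl addr0 => E.
have x0 : eps (x 0 e3) = 0.
  by rewrite -b0 -E rmorphM rmorphD rmorph1 /= l33 addr0 mulr1.
by move: E; rewrite mulrDr mulr1 (mul0 (x 0 e3)) // addr0.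
Qed.

(** The image of [t] lies in [m] and so squares to 0; splitting off two coefficients leaves a
    remainder divisible by that square. *)
Lemma infinitesimal_fps_morphism (f : {lrmorphism fps K -> A}) (x : fps K) :
  infinitesimal eps -> aug_morphism (@fps_aug K) eps f ->
  f x = (x 0%N : K)%:A + (x 1%N : K) *: f (fps_var K).
Proof.
move=> /infinitesimal_mul0 mul0 faug; have t0 : eps (f (fps_var K)) = 0 by rewrite faug.
rewrite [in LHS](fps_shift_decomp x) raddfD /= linearZ /= rmorph1 rmorphM /=; congr (_ + _).
rewrite (fps_shift_decomp (fps_shift x)) raddfD /= linearZ /= rmorph1 rmorphM /=.
by rewrite mulrDr mulrA (mul0 _ _ t0 t0) mul0r addr0 -scalerAr mulr1.
Qed.

End Deformations.

(** * Miniversality and the final statement *)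

Lemma miniversal_dinf (K : fieldType) :
  miniversal par21 (d12 K) (@fps_aug K) (dinf (fps_var K)).
Proof.
split=> [|B epsB fB inf dB defB f f' faug feq f'aug f'eq x].
  split; [exact: fps_formal_base | exact: deformation_dinf |].
  move=> B epsB [_ cB] dB /(deformation_equiv_dinf cB)[b b0 eqB].
  exists (fps_eval cB b0); split; first exact: aug_fps_eval.
  by rewrite base_change_dinf /= fps_eval_var.
(* Both morphisms are determined by the image of [t], and each such image equals the invariant
   coefficient [dB (e3, e3) 0 e3]. *)
rewrite (infinitesimal_fps_morphism x inf faug) (infinitesimal_fps_morphism x inf f'aug).
congr (_ + _ *: _).
rewrite !base_change_dinf in feq f'eq.
rewrite -(infinitesimal_dinf_coef inf _ feq); last by rewrite faug.
by rewrite -(infinitesimal_dinf_coef inf _ f'eq) // f'aug.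
Qed.

Theorem mainTheorem4 (R : realType) :
  miniversal par21 (d12 R[i]) (@fps_aug R[i]) (dinf (fps_var R[i])) /\
  exists2 eps : R, 0 < eps &
    forall t : R[i], t != 0 -> `|t| < eps%:C ->
      equivalent par21 (dinf t) (d1 R[i]).
Proof.
split; first exact: miniversal_dinf.
exists 1 => // t t0 _.
(* The scaling of the basis needs a square root of [- t], available over the complex numbers. *)
have -> : t = - sqrtC (- t) ^+ 2 by rewrite sqrtCK opprK.
by apply: equivalent_dinf_d1; rewrite sqrtC_eq0 oppr_eq0.
Qed.
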